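(* Over infinite full-binary trees the following hold: (1) For every integer $k>1$ there is a regular tree language that is $k$-ambiguous but not $(k-1)$-ambiguous. (2) There is a regular tree language that is finitely ambiguous but not boundedly ambiguous. (3) There is a regular tree language that is countably ambiguous but not finitely ambiguous. (4) There is a regular tree language (i.e. one accepted by some parity tree automaton, hence ''uncountably ambiguous'') that is not countably ambiguous.
   Context: The full-binary tree has node set $\{l,r\}^*$ with root $\epsilon$; the children of $v$ are $v\cdot l$ and $v\cdot r$. For a finite alphabet $\Sigma$, a $\Sigma$-labeled tree is a function $t:\{l,r\}^*\to\Sigma$; $T^\omega_\Sigma$ is the set of all such trees, and a tree language over $\Sigma$ is a subset of $T^\omega_\Sigma$. A parity tree automaton (PTA) is $\mathcal{A}=(Q,\Sigma,Q_I,\delta,\mathbb{C})$ with $Q$ finite, $Q_I\subseteq Q$ initial states, $\delta\subseteq Q\times\Sigma\times Q\times Q$, $\mathbb{C}:Q\to\mathbb{N}$. A computation of $\mathcal{A}$ on $t$ is $\phi:\{l,r\}^*\to Q$ with $\phi(\epsilon)\in Q_I$ and $(\phi(v),t(v),\phi(v\cdot l),\phi(v\cdot r))\in\delta$ for all $v$; it is accepting if along every branch (infinite sequence $v_0=\epsilon,v_1,\dots$ with each $v_{i+1}$ a child of $v_i$) the maximal color $\mathbb{C}(\phi(v_i))$ occurring infinitely often is even. $ACC(\mathcal{A},t)$ is the set of accepting computations, $L(\mathcal{A})=\{t: ACC(\mathcal{A},t)\neq\emptyset\}$; a tree language is regular if it is $L(\mathcal{A})$ for some PTA. $\mathcal{A}$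 is $k$-ambiguous if $|ACC(\mathcal{A},t)|\le k$ for all $t$; unambiguous if 1-ambiguous; boundedly ambiguous if $k$-ambiguous for some $k\in\mathbb{N}$; finitely (resp. countably) ambiguous if $ACC(\mathcal{A},t)$ is finite (resp. countable) for every $t$. A regular language is $k$-ambiguous (resp. boundedly, finitely, countably ambiguous) if it is accepted by some PTA with that property. *)

(* Defs.v *)
From HB Require Import structures.
From mathcomp Require Import all_boot all_order.
From mathcomp Require Import classical_sets cardinality.

Set Implicit Arguments.
Unset Strict Implicit.
Unset Printing Implicit Defensive.

Local Open Scope classical_set_scope.

(* Nodes of the full binary tree: words over {l,r}; false = l, true = r.
   The root is [::] and the children of v are rcons v false (v.l)
   and rcons v true (v.r). *)
Definition node := seq bool.

Definition tree (Sigma : Type) := node -> Sigma.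

Definition tree_language (Sigma : Type) := set (tree Sigma).

Record PTA (Sigma : finType) := MkPTA {
  pta_Q : finType;
  pta_init : {pred pta_Q};
  pta_delta : pta_Q -> Sigma -> pta_Q -> pta_Q -> bool;
  pta_col : pta_Q -> nat
}.
Arguments pta_Q {Sigma} p.
Arguments pta_init {Sigma} p.
Arguments pta_delta {Sigma} p.
Arguments pta_col {Sigma} p.

(* The i-th node v_i of the branch given by the direction sequence b:
   v_0 = eps, v_{i+1} = v_i . b i. Every branch arises this way. *)
Definition branch_node (b : nat -> bool) (i : nat) : node := mkseq b i.

Section Runs.
Variables (Sigma : finType) (A : PTA Sigma).

Definition computation (t : tree Sigma) (phi : node -> pta_Q A) : Prop :=
  pta_init A (phi [::]) /\
  forall v : node,
    pta_delta A (phi v) (t v) (phi (rcons v false)) (phi (rcons v true)).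

Definition max_inf_color_even (cs : nat -> nat) : Prop :=
  exists c : nat, ~~ odd c /\
    (forall n, exists2 m, n <= m & cs m = c) /\
    (exists N, forall m, N <= m -> cs m <= c).

Definition accepting (phi : node -> pta_Q A) : Prop :=
  forall b : nat -> bool,
    max_inf_color_even (fun i => pta_col A (phi (branch_node b i))).

Definition ACC (t : tree Sigma) : set (node -> pta_Q A) :=
  [set phi | computation t phi /\ accepting phi].

Definition lang : tree_language Sigma := [set t | ACC t !=set0].

Definition k_ambiguous (k : nat) : Prop :=
  forall t, exists f : 'I_k -> (node -> pta_Q A), ACC t `<=` range f.

Definition boundedly_ambiguous : Prop := exists k, k_ambiguous k.

Definition finitely_ambiguous : Prop := forall t, finite_set (ACC t).

Definition countably_ambiguous : Prop := forall t, countable (ACC t).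

End Runs.

Definition regular (Sigma : finType) (L : tree_language Sigma) : Prop :=
  exists A : PTA Sigma, L = lang A.

Definition k_ambiguous_lang (Sigma : finType) (L : tree_language Sigma)
  (k : nat) : Prop :=
  exists A : PTA Sigma, L = lang A /\ k_ambiguous A k.

Definition boundedly_ambiguous_lang (Sigma : finType)
  (L : tree_language Sigma) : Prop :=
  exists A : PTA Sigma, L = lang A /\ boundedly_ambiguous A.

Definition finitely_ambiguous_lang (Sigma : finType)
  (L : tree_language Sigma) : Prop :=
  exists A : PTA Sigma, L = lang A /\ finitely_ambiguous A.

Definition countably_ambiguous_lang (Sigma : finType)
  (L : tree_language Sigma) : Prop :=
  exists A : PTA Sigma, L = lang A /\ countably_ambiguous A.

(* Main.v *)
Require Import Defs.
From mathcomp Require Import all_boot.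
From mathcomp Require Import boolp classical_sets functions cardinality.
From mathcomp Require Import zify.

(* Let G be the tree all of whose trunk nodes 0^n are false and all of whose
   subtrees at the exits 0^n 1 are copies of one tree t.  If an automaton,
   reading G from a state q, can loop along the trunk from q back to q with odd
   maximal color, and if it also accepts G from q, then it has infinitely many
   accepting runs on G from q: loop n times, then switch to the accepting run.
   For every automaton there is a tree t, containing a true node, which forces
   this: from any state p that accepts t but not the all-false tree, an accepting
   run on t must contain such a loop, since otherwise jumping back along even
   loops would turn it into an accepting run on the all-false tree.  Hence p has
   infinitely many accepting runs on some tree.

   Now consider the languages "some exit i, with i in I, has an all-false
   subtree", where the index set I depends only on the labels of the trunk.
   Guessing i accepts such a language with one run per valid index.  Conversely,
   let an automaton for it be finitely ambiguous, and run it on the tree whose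
   i-th exit is all-false and whose other exits are t.  The states at the other
   exits accept t, hence also the all-false tree, so each i yields an accepting
   run on the tree whose exits are all all-false; these runs differ, because the
   state at exit i does not accept t.  Taking for I the indices below k, the
   indices below the first true label of the trunk, and all indices gives (1),
   (2) and (3).  For (4), take "every exit has a true node below it": each exit
   state has two runs on a suitable tree, hence uncountably many combinations. *)

Set Implicit Arguments.
Unset Strict Implicit.
Unset Printing Implicit Defensive.

Local Open Scope classical_set_scope.

(** * Runs along a trunk and its exits *)

Lemma max_inf_color_even_shift n (cs : nat -> nat) :
  max_inf_color_even (fun i => cs (n + i)) <-> max_inf_color_even cs.
Proof.
split=> -[c [c_even [c_inf [N c_max]]]]; exists c; split=> //; split.
- move=> m; have [k mk <-] := c_inf m; exists (n + k) => //; lia.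
- exists (n + N) => m Nm; have -> : m = n + (m - n) by lia.
  by apply: c_max; lia.
- move=> m; have [k mk <-] := c_inf (n + m); exists (k - n); first by lia.
  by congr cs; lia.
- by exists N => m Nm; apply: c_max; lia.
Qed.

(** A bound met infinitely often is the value sought; any other bound can be lowered on a tail. *)
Lemma max_inf_color_bounded (cs : nat -> nat) B : (forall n, cs n <= B) ->
  exists c, (forall n, exists2 m, n <= m & cs m = c) /\
            exists N, forall m, N <= m -> cs m <= c.
Proof.
move=> csB; have : exists N, forall m, N <= m -> cs m <= B by exists 0.
elim: B {csB} => [|B IH] [N NB].
  exists 0; split; last by exists N.
  move=> n; exists (maxn n N); first by lia.
  by have := NB (maxn n N); lia.
have [B_inf|] := pselect (forall n, exists2 m, n <= m & cs m = B.+1).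
  by exists B.+1; split => //; exists N.
move/existsNP=> [n B_fin]; apply: IH; exists (maxn n N) => m nm.
have := NB m ltac:(lia); rewrite leq_eqVlt => /orP[/eqP cm|]; last by lia.
by case: B_fin; exists m => //; lia.
Qed.

Definition subtree T (f : node -> T) (u : node) : node -> T :=
  fun v => f (u ++ v).

(** * Trees decomposed into a trunk and its exits *)

Section Spine.
Variable T : Type.
Implicit Types (f : node -> T) (h : nat -> T) (x : nat -> node -> T).

Definition trunk f (n : nat) : T := f (nseq n false).

Definition exit f (n : nat) : node -> T := fun v => f (nseq n false ++ true :: v).

Fixpoint spine h x (v : node) : T :=
  match v with
  | [::] => h 0
  | true :: w => x 0 w
  | false :: w => spine (h \o succn) (x \o succn) w
  end.

Lemma trunk_spine h x n : trunk (spine h x) n = h n.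
Proof. by rewrite /trunk; elim: n h x => //= n IH h x; rewrite IH. Qed.

Lemma exit_spine h x n : exit (spine h x) n = x n.
Proof.
apply/funext => v; rewrite /exit.
by elim: n h x => //= n IH h x; rewrite IH.
Qed.

Lemma spine_eta f : spine (trunk f) (exit f) = f.
Proof.
apply/funext => v; rewrite /trunk /exit.
elim: v f => //= -[] v IH f //; exact: (IH (subtree f [:: false])).
Qed.

End Spine.

Lemma branch_nodeS (b : nat -> bool) n :
  branch_node b n.+1 = b 0 :: branch_node (b \o succn) n.
Proof.
by rewrite /branch_node /mkseq /= -[1]addn0 iotaDl -map_comp.
Qed.

Lemma branch_node_false (b : nat -> bool) n :
  (forall i, b i = false) -> branch_node b n = nseq n false.
Proof.
elim: n b => [//|n IH] b b0; rewrite branch_nodeS b0 IH // => i; exact: b0.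
Qed.

(** * Accepting runs from an arbitrary state *)

Section Runs.
Variables (Sigma : finType) (A : PTA Sigma).
Implicit Types (t : tree Sigma) (phi : node -> pta_Q A) (q : pta_Q A).

(** The condition on the initial state is left out, so that the restriction of a run to a subtree is
    again a run. *)
Definition accepting_run t phi : Prop :=
  (forall v : node,
    pta_delta A (phi v) (t v) (phi (rcons v false)) (phi (rcons v true))) /\
  accepting phi.

Definition runs q t : set (node -> pta_Q A) :=
  [set phi | phi [::] = q /\ accepting_run t phi].

Definition accepts q t : Prop := runs q t !=set0.

Lemma ACC_runs t phi : ACC t phi <-> pta_init A (phi [::]) /\ accepting_run t phi.
Proof. by split=> [[[? ?] ?]|[? [? ?]]]. Qed.

Lemma accepting_run_accepts t phi : accepting_run t phi -> accepts (phi [::]) t.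
Proof. by move=> ?; exists phi. Qed.

Lemma accepting_run_node t phi : accepting_run t phi <->
  pta_delta A (phi [::]) (t [::]) (phi [:: false]) (phi [:: true]) /\
  forall d, accepting_run (subtree t [:: d]) (subtree phi [:: d]).
Proof.
split=> [[valid acc]|[valid0 sub]]; split.
- exact: (valid [::]).
- move=> d; split=> [v|b]; first exact: (valid (d :: v)).
  have := (max_inf_color_even_shift 1 _).2
    (acc (fun n => if n is n'.+1 then b n' else d)).
  by congr max_inf_color_even; apply/funext => n; rewrite add1n branch_nodeS.
- by case=> [//|d v]; have [valid _] := sub d; exact: valid.
- move=> b; apply/(max_inf_color_even_shift 1 _).1.
  have [_ /(_ (b \o succn))] := sub (b 0).
  by congr max_inf_color_even; apply/funext => n; rewrite add1n branch_nodeS.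
Qed.

Lemma accepting_run_subtree t phi u :
  accepting_run t phi -> accepting_run (subtree t u) (subtree phi u).
Proof.
elim: u t phi => [//|d u IH] t phi /accepting_run_node[_ sub].
exact: (IH _ _ (sub d)).
Qed.

Lemma accepting_run_exit t phi n :
  accepting_run t phi -> accepting_run (exit t n) (exit phi n).
Proof.
move/(accepting_run_subtree (nseq n false ++ [:: true])).
by congr accepting_run; apply/funext => v; rewrite /subtree -catA.
Qed.

Lemma accepting_run_trunk t phi n : accepting_run t phi ->
  pta_delta A (trunk phi n) (trunk t n) (trunk phi n.+1) (exit phi n [::]).
Proof.
move=> [valid _]; have := valid (nseq n false).
by rewrite -cats1 -(nseqD n 1) addn1 -cats1.
Qed.

Lemma accepting_run_trunk_color t phi : accepting_run t phi ->
  max_inf_color_even (pta_col A \o trunk phi).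
Proof.
move=> [_ /(_ (fun=> false))]; congr max_inf_color_even; apply/funext => n.
by rewrite branch_node_false.
Qed.

(** A branch either stays on the trunk or has a tail inside one exit, and acceptance depends only on
    tails. *)
Lemma accepting_run_spine h x hs psi :
  (forall n, pta_delta A (hs n) (h n) (hs n.+1) (psi n [::])) ->
  (forall n, accepting_run (x n) (psi n)) ->
  max_inf_color_even (pta_col A \o hs) ->
  accepting_run (spine h x) (spine hs psi).
Proof.
move=> valid exits trunk_good; split=> [v|b].
  elim: v h x hs psi valid exits {trunk_good} => [|d v IH] h x hs psi valid exits.
    exact: (valid 0).
  case: d => /=; first by case: (exits 0) => + _; apply.
  by apply: IH => n; [exact: valid | exact: exits].
have [b0|/existsNP[i]] := pselect (forall i, b i = false).
  move: trunk_good; congr max_inf_color_even; apply/funext => n /=.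
  by rewrite branch_node_false // -[hs n](trunk_spine hs psi).
move/eqP; rewrite eqbF_neg negbK => bi.
elim: i b h x hs psi exits bi {valid trunk_good} => [|i IH] b h x hs psi exits bi;
  apply/(max_inf_color_even_shift 1 _).1.
  have [_ /(_ (b \o succn))] := exits 0; congr max_inf_color_even.
  by apply/funext => n; rewrite add1n branch_nodeS bi.
(* The right turn at [i.+1] need not be the first one, so the branch may already leave the trunk
   here. *)
have [b0|b0] := boolP (b 0).
  have [_ /(_ (b \o succn))] := exits 0; congr max_inf_color_even.
  by apply/funext => n; rewrite add1n branch_nodeS b0.
have := IH (b \o succn) (h \o succn) (x \o succn) (hs \o succn) (psi \o succn)
  (fun n => exits n.+1) bi.
congr max_inf_color_even; apply/funext => n.
by rewrite add1n branch_nodeS (negbTE b0).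
Qed.

Lemma accepting_run_replace_exits h x y phi psi :
  accepting_run (spine h x) phi ->
  (forall n, runs (exit phi n [::]) (y n) (psi n)) ->
  accepting_run (spine h y) (spine (trunk phi) psi).
Proof.
move=> run psiP; apply: accepting_run_spine => [n|n|].
- have [-> _] := psiP n; rewrite -[h n](trunk_spine h x).
  exact: accepting_run_trunk.
- by have [] := psiP n.
- exact: (accepting_run_trunk_color run).
Qed.

Lemma accepts_exit h x phi n : accepting_run (spine h x) phi ->
  accepts (exit phi n [::]) (x n).
Proof.
move=> run; rewrite -(exit_spine h x n).
exact/accepting_run_accepts/accepting_run_exit.
Qed.

(** With the trunk labels fixed, acceptance depends on the exits only through the sets of states
    that accept them: keep the run on the trunk and exchange the runs on the exits. *)
Lemma accepts_spine_mono q h x y :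
  (forall n p, accepts p (x n) -> accepts p (y n)) ->
  accepts q (spine h x) -> accepts q (spine h y).
Proof.
move=> xy [phi [phi0 run]].
have /choice[psi psiP] : forall n, exists psi, runs (exit phi n [::]) (y n) psi.
  by move=> n; apply/xy/accepts_exit/run.
exists (spine (trunk phi) psi); split=> //.
exact: accepting_run_replace_exits run psiP.
Qed.

Definition infinitely_accepting q : Prop :=
  exists s : tree Sigma, ~ finite_set (runs q s).

Definition graft T (a : T) (f0 f1 : node -> T) (v : node) : T :=
  match v with [::] => a | d :: w => (if d then f1 else f0) w end.

(** One step up, the tree found for the child is placed beside the sibling subtree of [t], on which
    [phi] itself supplies a run; so every run from the state of the child extends. *)
Lemma infinitely_accepting_node t phi u : accepting_run t phi ->
  infinitely_accepting (phi u) -> infinitely_accepting (phi [::]).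
Proof.
elim: u t phi => [//|d u IH] t phi run inf.
have /accepting_run_node[valid sub] := run.
have [s s_inf] := IH _ _ (sub d) inf.
pose put T (f g : node -> T) :=
  graft (f [::]) (if d then subtree f [:: false] else g)
        (if d then g else subtree f [:: true]).
exists (put _ t s) => fin; apply: s_inf.
apply: (@sub_finite_set _ _ ((fun rho => subtree rho [:: d]) @`
   runs (phi [::]) (put _ t s))); last exact: finite_image.
move=> psi [psi0 run_psi]; exists (put _ phi psi); last first.
  by apply/funext => v; rewrite /subtree /put; case: (d).
split=> //; apply/accepting_run_node; split.
  by move: psi0 valid; rewrite /put /subtree /graft; case: (d) => /= ->.
move=> d'; have := sub d'; move: run_psi; rewrite /put /subtree.
by case: (d); case: d'.
Qed.

Lemma finitely_ambiguous_init q : finitely_ambiguous A -> pta_init A q ->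
  ~ infinitely_accepting q.
Proof.
move=> fin q_init [s]; apply; apply: sub_finite_set (fin s).
by move=> phi [phi0 run]; apply/ACC_runs; rewrite phi0.
Qed.

End Runs.

(** * Runs with back jumps *)

Lemma argmax_interval (c : nat -> nat) a b : a <= b ->
  exists y, a <= y <= b /\ forall y', a <= y' <= b -> c y' <= c y.
Proof.
elim: b => [|b IH] ab.
  by exists 0; split=> [|y' ?]; [lia | have -> : y' = 0 by lia].
have [aE|ab'] : a = b.+1 \/ a <= b by lia.
  by exists b.+1; split=> [|y' ?]; [lia | have -> : y' = b.+1 by lia].
have [y [yab ymax]] := IH ab'.
have [cb|cb] := leqP (c b.+1) (c y).
  exists y; split=> [|y' ?]; first by lia.
  have [->//|?] : y' = b.+1 \/ y' <= b by lia.
  by apply: ymax; lia.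
exists b.+1; split=> [|y' ?]; first by lia.
have [->//|?] : y' = b.+1 \/ y' <= b by lia.
by apply: leq_trans (ltnW cb); apply: ymax; lia.
Qed.

Lemma take_rcons (u : node) d k : k <= size u -> take k (rcons u d) = take k u.
Proof. by move=> ku; rewrite -cats1 takel_cat. Qed.

Section BackJumps.
Variables (Sigma : finType) (A : PTA Sigma) (phi : node -> pta_Q A).
Variable jump : node -> node.
Hypothesis phi_acc : accepting phi.
Local Notation col u := (pta_col A (phi u)).

(* The colors met between the target and the source of a jump have an even
   maximum, so that excising the detour does not spoil acceptance. *)
Hypothesis jumpP : forall y, jump y = y \/
  exists s, [/\ s < size y, jump y = take s y, phi (take s y) = phi y &
    exists m, [/\ s <= m <= size y, ~~ odd (col (take m y)) &
      forall k, s <= k <= size y -> col (take k y) <= col (take m y)]].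

(** The node of the original tree whose state is used at [v]: each direction is one step down
    followed by a jump. *)
Definition jump_walk (v : node) : node :=
  foldl (fun x d => jump (rcons x d)) [::] v.

Lemma jump_walk_rcons v d :
  jump_walk (rcons v d) = jump (rcons (jump_walk v) d).
Proof. by rewrite /jump_walk foldl_rcons. Qed.

Lemma phi_jump y : phi (jump y) = phi y.
Proof. by case: (jumpP y) => [->//|[s [_ -> -> _]]]. Qed.

Lemma jump_take y : exists2 s, s <= size y & jump y = take s y.
Proof.
case: (jumpP y) => [E|[s [sy E _ _]]]; last by exists s => //; lia.
by exists (size y) => //; rewrite take_size.
Qed.

(** If the maximal recurring color [c] of the walk were odd, no jump could pass back over a late
    visit to color [c], since excised segments have even maximum. These visits would then lie on one
    branch, on which [phi] itself has maximal recurring color [c]. *)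
Lemma accepting_jump_walk : accepting (phi \o jump_walk).
Proof.
move=> b; pose x n := jump_walk (branch_node b n).
have xS n : x n.+1 = jump (rcons (x n) (b n)).
  by rewrite /x /branch_node mkseqS jump_walk_rcons.
pose C := fun n => col (x n).
have [B CB] : exists B, forall q, pta_col A q <= B.
  by exists (\max_q pta_col A q) => q; exact: leq_bigmax.
have [c [c_inf [N0 c_max]]] := max_inf_color_bounded (fun n => CB (phi (x n))).
rewrite -/(max_inf_color_even C).
have [c_odd|c_even] := boolP (odd c); last first.
  by exists c; split=> //; split=> //; exists N0.
have [n0 N0n0 n0min] :
    exists2 n0, N0 <= n0 & forall n, N0 <= n -> size (x n0) <= size (x n).
  have ex : exists l, `[< exists2 n, N0 <= n & size (x n) = l >].
    by exists (size (x N0)); apply/asboolP; exists N0.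
  case: (ex_minnP ex) => l /asboolP[n0 N0n0 <-] l_min.
  by exists n0 => // n Nn; apply: l_min; apply/asboolP; exists n.
(* From time [n0] on, every node between [x n0] and the current position has
   been visited after time [N0]. *)
have visited n : n0 <= n ->
    forall k, size (x n0) <= k <= size (x n) -> col (take k (x n)) <= c.
  elim: n => [|n IH] n0n k kn.
    have E : n0 = 0 by lia.
    have Ek : k = size (x 0) by move: kn; rewrite E; lia.
    by rewrite Ek take_size; apply: c_max; lia.
  have [E|n0n'] : n0 = n.+1 \/ n0 <= n by lia.
    have Ek : k = size (x n.+1) by move: kn; rewrite E; lia.
    by rewrite Ek take_size; apply: c_max; lia.
  have [kE|kx] : k = size (x n.+1) \/ k < size (x n.+1) by lia.
    by rewrite kE take_size; apply: c_max; lia.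
  move: kn kx; rewrite xS; have [s sy ->] := jump_take (rcons (x n) (b n)).
  rewrite size_takel // => kn kx; rewrite size_rcons in sy.
  rewrite take_takel; last by lia.
  rewrite take_rcons; last by lia.
  by apply: IH => //; lia.
have growth n : n0 <= n -> C n = c -> forall m, n < m ->
    take (size (x n)) (x m) = x n /\ size (x n) < size (x m).
  move=> n0n Cn m nm.
  have : take (size (x n)) (x m) = x n /\ size (x n) + (n < m) <= size (x m);
    last by rewrite nm addn1.
  have /ltnW := nm; clear nm.
  elim: m => [|m IH] nm.
    have E : n = 0 by lia.
    by rewrite E ltnn addn0 take_size.
  have [E|nm'] : n = m.+1 \/ n <= m by lia.
    by rewrite E ltnn addn0 take_size.
  have [pre sz] := IH nm'; rewrite ltnS nm'.
  set y := rcons (x m) (b m).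
  have szy : size y = (size (x m)).+1 by rewrite /y size_rcons.
  have prey : take (size (x n)) y = x n by rewrite /y take_rcons //; lia.
  case: (jumpP y) => [E|[s [sy Es phis [a [sa a_even a_max]]]]].
    by rewrite xS E prey szy; split=> //; lia.
  rewrite xS Es size_takel; last by lia.
  have [sn|ns] := leqP s (size (x n)); last first.
    by rewrite take_takel // ?prey; [split=> //; lia | lia].
  (* The jump lands at or above [x n], so its segment contains the color [c]; its even maximum is
     also at most [c], which is odd. *)
  exfalso.
  have szm : size (x n0) <= s.
    have := n0min m.+1 ltac:(lia); rewrite xS Es size_takel //; lia.
  have := a_max (size (x n)) ltac:(lia); rewrite prey -/(C n) Cn.
  suff : col (take a y) <= c.
    move=> h1 h2; have E : col (take a y) = c by lia.
    by move: a_even; rewrite E c_odd.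
  (* The lower end [y] of the segment need not have been visited, but it has the state of the jump
     target, which is visited at time [m.+1]. *)
  have [Ea|am] : a = size y \/ a <= size (x m) by lia.
    rewrite Ea take_size -phi_jump -xS -/(C m.+1).
    by apply: c_max; lia.
  rewrite take_rcons //; apply: visited; lia.
have growth_eq n m i : n0 <= n -> C n = c -> n <= m -> i <= size (x n) ->
    take i (x m) = take i (x n).
  move=> n0n Cn nm ile.
  have [->//|nm'] : n = m \/ n < m by lia.
  have [pre _] := growth n n0n Cn m nm'.
  by rewrite -[in RHS]pre take_takel.
have long l : exists n, [/\ n0 <= n, C n = c & l <= size (x n)].
  elim: l => [|l [n [n0n Cn ln]]].
    by have [n n0n Cn] := c_inf n0; exists n.
  have [m nm Cm] := c_inf n.+1.
  have [_ ?] := growth n n0n Cn m nm.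
  by exists m; split=> //; lia.
have [m mP] := choice long.
(* [beta] is the limit branch of the growing positions of color [c]. *)
pose beta i := nth false (x (m i.+1)) i.
have beta_node n l : n0 <= n -> C n = c -> l <= size (x n) ->
    branch_node beta l = take l (x n).
  move=> n0n Cn ln; apply: (@eq_from_nth _ false).
    by rewrite /branch_node size_mkseq size_takel.
  rewrite /branch_node size_mkseq => i il.
  rewrite nth_mkseq // nth_take // /beta.
  have [n0m Cm mi] := mP i.+1.
  have [mn|nm] := leqP (m i.+1) n.
    by rewrite -(nth_take _ (ltnSn i)) -(growth_eq (m i.+1) n) // nth_take.
  have E := growth_eq n (m i.+1) i.+1 n0n Cn (ltnW nm) (leq_trans il ln).
  by rewrite -(nth_take _ (ltnSn i)) E nth_take.
have [e [e_even [e_inf [N1 e_max]]]] := phi_acc beta.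
suff E : e = c by move: e_even; rewrite E c_odd.
apply/eqP; rewrite eqn_leq; apply/andP; split.
  have [i ni Ei] := e_inf (size (x n0)).
  have [n [n0n Cn ln]] := long i.
  by rewrite -Ei (beta_node n) //; apply: visited => //; lia.
have [n [n0n Cn ln]] := long N1.
have := e_max _ ln; rewrite (beta_node n) // take_size.
by move: Cn; rewrite /C => ->.
Qed.

End BackJumps.

(** * Trees forcing infinite ambiguity *)

Section ResetTree.
Variables N M : nat.

(** A state is the level together with the number of left turns since the last right turn; a right
    turn that comes too early sends the level back to 0. *)
Definition reset_step (s : nat * nat) (d : bool) : nat * nat :=
  if d then (if N <= s.2 then (s.1.+1, 0) else (0, 0)) else (s.1, s.2.+1).

Definition reset_tree (s : nat * nat) : tree bool :=
  fun v => (foldl reset_step s v).1 == M.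

Lemma reset_step_false s n :
  foldl reset_step s (nseq n false) = (s.1, s.2 + n).
Proof.
elim: n s => [|n IH] [m z] /=; first by rewrite addn0.
by rewrite IH /= addSnnS.
Qed.

Lemma subtree_reset_tree s u :
  subtree (reset_tree s) u = reset_tree (foldl reset_step s u).
Proof. by apply/funext => v; rewrite /subtree /reset_tree foldl_cat. Qed.

Lemma reset_tree_spine m z : m < M -> reset_tree (m, z) =
  spine (fun=> false)
        (fun n => reset_tree (if N <= z + n then (m.+1, 0) else (0, 0))).
Proof.
move=> mM; rewrite -[LHS]spine_eta; congr spine; apply/funext => n.
  by rewrite /trunk /reset_tree reset_step_false ltn_eqF.
apply/funext => v.
by rewrite /exit /reset_tree foldl_cat reset_step_false.
Qed.

Lemma reset_tree_true : exists v, reset_tree (0, 0) v = true.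
Proof.
pose w k := flatten (nseq k (rcons (nseq N false) true)).
suff H k m : foldl reset_step (m, 0) (w k) = (m + k, 0).
  by exists (w M); rewrite /reset_tree H eqxx.
elim: k m => [|k IH] m; first by rewrite addn0.
rewrite /w /= foldl_cat foldl_rcons reset_step_false /= /reset_step /= add0n leqnn.
by rewrite IH addSnnS.
Qed.

End ResetTree.

Section Core.
Variable A : PTA bool.
Implicit Types (phi : node -> pta_Q A) (q p : pta_Q A).

(** [N] left turns in a row visit [N + 1] nodes and hence repeat a state; among the levels 0 to [M],
    two are accepted from the same set of states. *)
Let N := #|pta_Q A|.
Let M := #|{set pta_Q A}|.
Local Notation gen := (reset_tree N M).
Let G : tree bool := spine (fun=> false) (fun=> gen (0, 0)).

Let accepting_states (t : tree bool) : {set pta_Q A} :=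
  [set q | `[< accepts q t >]]%SET.

Lemma accepting_states_sub t s q : accepting_states t = accepting_states s ->
  accepts q t -> accepts q s.
Proof.
by move=> E /asboolP qt; have : q \in accepting_states s;
  [rewrite -E inE | rewrite inE => /asboolP].
Qed.

(** The exits of a level are copies of the next level or of level 0, and which of the two occurs at
    an exit does not depend on the level. *)
Lemma accepting_states_gen i j : i < M -> j < M ->
  accepting_states (gen (i.+1, 0)) = accepting_states (gen (j.+1, 0)) ->
  accepting_states (gen (i, 0)) = accepting_states (gen (j, 0)).
Proof.
move=> iM jM E; apply/setP => q; rewrite !inE.
rewrite (reset_tree_spine _ _ iM) (reset_tree_spine _ _ jM).
apply/asbool_equiv_eq; split; apply: accepts_spine_mono => n p; case: ifP => // _;
  exact: accepting_states_sub.
Qed.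

(* The levels are pairwise computed from the next one by the same operation, so
   two levels accepted from the same states can be shifted down to level 0. *)
Lemma accepting_states_period : exists2 r, r < M &
  accepting_states (gen (r.+1, 0)) = accepting_states (gen (0, 0)).
Proof.
have [i [j [ij jM E]]] : exists i j, [/\ i < j, j <= M &
    accepting_states (gen (i, 0)) = accepting_states (gen (j, 0))].
  have /injectivePn[i [j ij E]] : ~~ injectiveb
      (fun i : 'I_M.+1 => accepting_states (gen (i : nat, 0))).
    by apply/injectiveP => /leq_card; rewrite card_ord ltnn.
  have [lij|lij|/val_inj E'] := ltngtP i j.
  - by exists i, j; split=> //; have := ltn_ord j.
  - by exists j, i; split=> //; have := ltn_ord i.
  - by rewrite E' eqxx in ij.
elim: i j ij jM E => [|i IH] [//|j] ij jM E; first by exists j.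
by apply: (IH j) => //; [lia | apply: accepting_states_gen => //; lia].
Qed.

Section Level.
Variable r : nat.
Hypothesis rM : r < M.
Hypothesis r_period :
  accepting_states (gen (r.+1, 0)) = accepting_states (gen (0, 0)).

(** Each exit is at level [r.+1] or 0, and by the choice of [r] both are accepted from the same
    states. *)
Lemma accepts_trap q z : accepts q (gen (r, z)) -> accepts q G.
Proof.
rewrite (reset_tree_spine _ _ rM); apply: accepts_spine_mono => n p.
by case: ifP => // _; exact: accepting_states_sub.
Qed.

(** * Odd loops yield infinitely many runs *)

Section OddLoop.
Variables (phi : node -> pta_Q A) (z k : nat).
Hypothesis phi_run : accepting_run (gen (r, z)) phi.
Hypothesis k_gt0 : 0 < k.
Hypothesis kN : z + k <= N.
Hypothesis phi_loop : trunk phi k = trunk phi 0.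
Variable y : nat.
Hypothesis y_le : y <= k.
Hypothesis y_max : forall i, i <= k ->
  pta_col A (trunk phi i) <= pta_col A (trunk phi y).
Hypothesis y_odd : odd (pta_col A (trunk phi y)).

Let q := trunk phi 0.

Definition prepend T (f g : node -> T) : node -> T :=
  spine (fun n => if n < k then trunk f n else trunk g (n - k))
        (fun n => if n < k then exit f n else exit g (n - k)).

(** Since [z + k <= N], the first [k] exits read by [phi] are at level 0, exactly like those of
    [G]. *)
Lemma runs_prepend psi : runs q G psi -> runs q G (prepend phi psi).
Proof.
move=> [psi0 psi_run]; split; first by rewrite /prepend /= k_gt0.
apply: accepting_run_spine => [n|n|].
- have [nk|kn] := ltnP n k.
    have := accepting_run_trunk n phi_run.
    rewrite {1}(reset_tree_spine _ _ rM) trunk_spine.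
    have [//|nk'] := ltnP n.+1 k.
    have E : n.+1 = k by lia.
    by rewrite E subnn phi_loop /trunk /= psi0.
  have := accepting_run_trunk (n - k) psi_run.
  by rewrite trunk_spine subSn // ifN // -leqNgt ltnW.
- have [nk|kn] := ltnP n k.
    have := accepting_run_exit n phi_run.
    by rewrite (reset_tree_spine _ _ rM) exit_spine ifN //; lia.
  by have := accepting_run_exit (n - k) psi_run; rewrite exit_spine.
- apply/(max_inf_color_even_shift k _).1.
  have := accepting_run_trunk_color psi_run.
  congr max_inf_color_even; apply/funext => n /=.
  by rewrite ltnNge leq_addr /= addKn.
Qed.

Let follows n psi := forall i, i < n -> trunk psi i = trunk phi (i %% k).

Lemma loop_not_accepting psi : runs q G psi -> ~ forall n, follows n psi.
Proof.
move=> [_ /accepting_run_trunk_color[c [c_even [c_inf [n0 c_max]]]]] fol.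
have col i : pta_col A (trunk psi i) <= pta_col A (trunk phi y).
  by rewrite (fol i.+1) //; apply: y_max; apply/ltnW/ltn_pmod.
suff E : c = pta_col A (trunk phi y) by move: c_even; rewrite E y_odd.
apply/eqP; rewrite eqn_leq; apply/andP; split.
  by have [i _ <-] := c_inf 0; exact: col.
(* The maximal color recurs in every round of the loop; after [n0] rounds the position is beyond
   [n0], as [k] is positive. *)
have := c_max (n0 * k + y); rewrite /= (fol (n0 * k + y).+1) // modnMDl.
have -> : trunk phi (y %% k) = trunk phi y.
  have [E|yk] : y = k \/ y < k by lia.
    by rewrite E modnn phi_loop.
  by rewrite modn_small.
by apply; nia.
Qed.

Lemma odd_loop_infinitely_accepting : infinitely_accepting q.
Proof.
exists G => fin.
have long n : exists2 psi, runs q G psi & follows n psi.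
  elim: n => [|n [psi psi_run fol]].
    have [psi psi_run] : accepts q G.
      exact: accepts_trap (accepting_run_accepts phi_run).
    by exists psi.
  exists (prepend phi psi); first exact: runs_prepend.
  move=> i i_lt; rewrite /prepend trunk_spine.
  have [ik|ki] := ltnP i k; first by rewrite modn_small.
  rewrite fol; last by lia.
  by rewrite -[in RHS](subnK ki) modnDr.
have /choice[bad badP] : forall psi, exists n, runs q G psi -> ~ follows n psi.
  move=> psi; have [run|nrun] := pselect (runs q G psi); last by exists 0.
  by have /existsNP[n] := loop_not_accepting run; exists n.
have /finite_seqP[s sE] := fin.
(* This run follows the loop at least as long as every bad length, its own included. *)
have [psi psi_run fol] := long (\max_(psi <- s) bad psi).
apply: (badP psi psi_run) => i i_lt; apply: fol; apply: leq_trans i_lt _.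
apply: (leq_bigmax_seq (P := predT)) => //.
by have : [set` s] psi by rewrite -sE.
Qed.

End OddLoop.

(** * Even loops can be cut out *)

Section EvenLoops.
Variable phi : node -> pta_Q A.
Hypothesis phi_run : accepting_run (gen (0, 0)) phi.
Local Notation st u := (foldl (reset_step N) (0, 0) u).
Local Notation zeros z := (nseq z false).

Definition even_loops : Prop := forall u z z', st u = (r, 0) ->
  z < z' <= N -> phi (u ++ zeros z') = phi (u ++ zeros z) ->
  exists m, [/\ z <= m <= z', ~~ odd (pta_col A (phi (u ++ zeros m))) &
    forall i, z <= i <= z' ->
      pta_col A (phi (u ++ zeros i)) <= pta_col A (phi (u ++ zeros m))].

Hypothesis loops_even : even_loops.

Let back (v w : node) := exists u z z', [/\ st u = (r, 0), z < z' <= N,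
  v = u ++ zeros z', w = u ++ zeros z & phi w = phi v].

(** The default [v] means staying put when no jump is possible. *)
Let jump v := xget v [set w | back v w].

Let jump_back v : back v (jump v) \/ jump v = v /\ forall w, ~ back v w.
Proof.
have [ex|nex] := pselect (exists w, back v w); first by left; exact: (xgetPex v ex).
right; have nb w : ~ back v w by move=> ?; apply: nex; exists w.
by split=> //; rewrite /jump xgetPN.
Qed.

Let st_zeros u n : st u = (r, 0) -> st (u ++ zeros n) = (r, n).
Proof. by move=> stu; rewrite foldl_cat stu reset_step_false. Qed.

Let jumpP y : jump y = y \/
  exists s, [/\ s < size y, jump y = take s y, phi (take s y) = phi y &
    exists m, [/\ s <= m <= size y, ~~ odd (pta_col A (phi (take m y))) &
      forall k, s <= k <= size y ->
        pta_col A (phi (take k y)) <= pta_col A (phi (take m y))]].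
Proof.
have [[u [z [z' [stu zz' yE jE phiE]]]]|[->]] := jump_back y; last by left.
right; exists (size u + z).
have szy : size y = size u + z' by rewrite yE size_cat size_nseq.
have takeE i : i <= z' -> take (size u + i) y = u ++ zeros i.
  by move=> iz; rewrite yE takeD take_size_cat // drop_size_cat // take_nseq.
have [m [zm m_even m_max]] := loops_even stu zz' ltac:(by rewrite -yE -jE).
split; [lia | by rewrite takeE //; lia | by rewrite takeE -?jE //; lia |].
exists (size u + m); split; [lia | by rewrite takeE //; lia |].
move=> k ks; have -> : k = size u + (k - size u) by lia.
by rewrite !takeE ?m_max //; lia.
Qed.

(** Invariant of the walk: at level [r] all states since the entry [u] are distinct, so fewer than
    [N] left turns were made and a right turn falls back to level 0. *)
Let below v := (st v).1 < r \/ exists u z, [/\ v = u ++ zeros z, st u = (r, 0) &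
  forall a b, a < b <= z -> phi (u ++ zeros a) <> phi (u ++ zeros b)].

Let below_reset v m : m <= r -> st v = (m, 0) -> below v.
Proof.
move=> mr stv; have [mE|lt_mr] : m = r \/ m < r by lia.
  right; exists v, 0; rewrite cats0 stv mE; split=> // a b; lia.
by left; rewrite stv.
Qed.

Let below_jump v d : below v -> below (jump (rcons v d)).
Proof.
(* Jumps start only at level [r] and after at least one left turn. *)
have jump_low w : (st w).1 < r \/ (st w).2 = 0 -> jump w = w.
  move=> low; have [[u [z [z' [stu zz' wE _ _]]]]|[]//] := jump_back w.
  by move: low; rewrite wE st_zeros //= => -[|] E; lia.
move=> [vr|[u [z [vE stu inj]]]].
  case E : (st v) vr => [m z] /= mr.
  have E' : st (rcons v d) = reset_step N (m, z) d by rewrite foldl_rcons E.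
  move: E'; case: d => /= E'; last by rewrite jump_low; left; rewrite E'.
  rewrite jump_low; last by right; rewrite E'; case: ifP.
  by move: E'; case: ifP => _; apply: below_reset.
have stv : st v = (r, z) by rewrite vE st_zeros.
have zN : z < N.
  pose f (i : 'I_z.+1) := phi (u ++ zeros i).
  suff /leq_card : injective f by rewrite card_ord.
  move=> i j fij; apply/val_inj; have [lij|lji|//] := ltngtP i j.
    by case: (inj i j) => //; rewrite lij -ltnS ltn_ord.
  by case: (inj j i) => //; rewrite lji -ltnS ltn_ord.
have E' : st (rcons v d) = reset_step N (r, z) d by rewrite foldl_rcons stv.
move: E'; case: d => /= E'.
  move: E'; rewrite leqNgt zN /= => E'.
  rewrite jump_low; last by right; rewrite E'.
  exact: below_reset E'.
have yE : rcons v false = u ++ zeros z.+1.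
  by rewrite vE -cats1 -catA -(nseqD z 1) addn1.
have [[u' [z1 [z' [stu' zz' wE jE phiE]]]]|[-> nb]] := jump_back (rcons v false).
  have z'E : z' = z.+1 by move: E'; rewrite wE st_zeros // => -[].
  have u'E : u' = u.
    have /eqP := wE; rewrite yE z'E eqseq_cat; first by move=> /andP[/eqP].
    by have /(congr1 size) := wE; rewrite yE z'E !size_cat !size_nseq => /addIn.
  (* The target is no deeper than [v], so distinctness is inherited. *)
  right; exists u, z1; split=> //; first by rewrite jE u'E.
  by move=> a b ab; apply: inj; lia.
(* As no jump is possible, the new state differs from all earlier ones since [u]. *)
right; exists u, z.+1; split=> // a b ab.
have [bE|bz] : b = z.+1 \/ b <= z by lia.
  move=> phiE; case: (nb (u ++ zeros a)).
  by exists u, a, z.+1; split=> //; [lia | rewrite yE phiE bE].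
by apply: inj; lia.
Qed.

(** The walk stays at levels at most [r < M], where all labels are false, and jumps keep the state,
    so the transitions of [phi] remain valid. *)
Lemma even_loops_accepts : accepts (phi [::]) (fun=> false).
Proof.
have low v : below (jump_walk jump v).
  elim/last_ind: v => [|v d IH]; first exact: below_reset (leq0n r) _.
  by rewrite jump_walk_rcons; exact: below_jump.
have [valid acc] := phi_run.
exists (phi \o jump_walk jump); split=> //; split; last exact: accepting_jump_walk.
move=> v; have := valid (jump_walk jump v).
have -> : gen (0, 0) (jump_walk jump v) = false.
  rewrite /reset_tree ltn_eqF //; case: (low v) => [|[u [z [-> stu _]]]]; first by lia.
  by rewrite st_zeros.
by rewrite /= !jump_walk_rcons !(phi_jump jumpP).
Qed.

End EvenLoops.

End Level.

Lemma forcing_tree : exists2 t : tree bool, (exists v, t v = true) &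
  forall p, accepts p t -> accepts p (fun=> false) \/ infinitely_accepting p.
Proof.
have [r rM r_period] := accepting_states_period.
exists (gen (0, 0)) => [|p [phi [<- phi_run]]]; first exact: reset_tree_true.
have [even|] := pselect (even_loops r phi).
  by left; exact: (even_loops_accepts rM phi_run).
move=> not_even; right; apply: contrapT => not_inf; apply: not_even.
move=> u z z' stu zz' loop.
have [m [mz m_max]] := argmax_interval
  (fun i => pta_col A (phi (u ++ nseq i false))) (a := z) (b := z') ltac:(lia).
exists m; split=> //; apply/negP => m_odd; apply: not_inf.
set w := u ++ nseq z false.
have run : accepting_run (gen (r, z)) (subtree phi w).
  have := accepting_run_subtree w phi_run.
  by rewrite subtree_reset_tree /w foldl_cat stu reset_step_false.
have trunkE i : trunk (subtree phi w) i = phi (u ++ nseq (z + i) false).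
  by rewrite /trunk /subtree /w -catA -nseqD.
(* The odd loop starts at [w]; infinite ambiguity is carried up from there to the root. *)
apply: (infinitely_accepting_node (u := w) phi_run).
have := @odd_loop_infinitely_accepting r rM r_period (subtree phi w) z (z' - z)
  run ltac:(lia) ltac:(lia) _ (m - z) ltac:(lia).
rewrite !trunkE addn0 !subnKC; [|lia|lia].
apply => // i iz; rewrite trunkE; apply: m_max; lia.
Qed.

End Core.

(** * Lower bounds *)

Definition some_exit_false (I : (nat -> bool) -> set nat) : tree_language bool :=
  [set t | exists2 i, I (trunk t) i & forall w, exit t i w = false].

Definition every_exit_true : tree_language bool :=
  [set t | forall n, exists w, exit t n w = true].

(** Cantor's diagonal argument: [d] would differ from every [g] at the code [f g]. *)
Lemma no_injection_functions_nat (f : (nat -> bool) -> nat) : ~ injective f.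
Proof.
move=> f_inj; pose d n := ~~ `[< exists2 g, f g = n & g n = true >].
have [dd|ndd] := boolP (d (f d)).
  by have := dd => /asboolPn; apply; exists d.
have /negPn/asboolP[g /f_inj gd] := ndd; rewrite gd => dd.
by rewrite dd in ndd.
Qed.

Section LowerBounds.
Variable A : PTA bool.
Implicit Types (phi : node -> pta_Q A).

Lemma some_exit_false_runs I (h : nat -> bool) : lang A = some_exit_false I ->
  finitely_ambiguous A -> I h !=set0 ->
  exists g : nat -> node -> pta_Q A,
    (forall i, I h i -> ACC (spine h (fun=> fun=> false)) (g i)) /\
    (forall i j, I h i -> I h j -> g i = g j -> i = j).
Proof.
move=> langA fin [i0 hi0]; have [t [v tv] t_forcing] := forcing_tree A.
pose x (i j : nat) : tree bool := if j == i then fun=> false else t.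
have xne i j : j != i -> x i j = t by rewrite /x => /negbTE->.
(* The index of a good run can be read off: it is the only exit whose state rejects [t]. *)
pose good i (g : node -> pta_Q A) := [/\ ACC (spine h (fun=> fun=> false)) g,
    ~ accepts (exit g i [::]) t &
    forall j, j != i -> accepts (exit g j [::]) t].
have good_ex i : I h i -> exists g, good i g.
  move=> hi; have : some_exit_false I (spine h (x i)).
    exists i => [|w]; last by rewrite exit_spine /x eqxx.
    by rewrite (_ : trunk _ = h) //; apply/funext => n; rewrite trunk_spine.
  rewrite -langA => -[phi /ACC_runs[phi0 run]].
  have /choice[psi psiP] : forall j, exists psi,
      runs (exit phi j [::]) (fun=> false) psi.
    move=> j; have := accepts_exit j run; have [->|ji] := eqVneq j i.
      by rewrite /x eqxx.
    rewrite xne // => /t_forcing[//|inf].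
    have := infinitely_accepting_node (u := nseq j false ++ [:: true]) run inf.
    by move/(finitely_ambiguous_init fin phi0).
  exists (spine (trunk phi) psi); split.
  - by apply/ACC_runs; split=> //; exact: accepting_run_replace_exits run psiP.
  - rewrite exit_spine; have [-> _] := psiP i => acc_i.
    (* Otherwise all exit states accept [t], and a tree none of whose exits is all-false would be
       accepted. *)
    have /choice[psi' psi'P] : forall j, exists psi', runs (exit phi j [::]) t psi'.
      move=> j; have [->//|ji] := eqVneq j i.
      by have := accepts_exit j run; rewrite xne.
    have : lang A (spine h (fun=> t)).
      exists (spine (trunk phi) psi'); apply/ACC_runs; split=> //.
      exact: accepting_run_replace_exits run psi'P.
    by rewrite langA => -[j _ /(_ v)]; rewrite exit_spine tv.
  - move=> j ji; rewrite exit_spine; have [-> _] := psiP j.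
    by have := accepts_exit j run; rewrite xne.
have [phi0 _] := good_ex i0 hi0.
have /choice[g gP] : forall i, exists g, I h i -> good i g.
  move=> i; have [/good_ex[g]|nhi] := pselect (I h i); first by exists g.
  by exists phi0.
exists g; split=> [i /gP[]//|i j hi hj gij].
apply: contrapT => /eqP ij.
have [_ + _] := gP i hi; apply; rewrite gij.
by have [_ _] := gP j hj; apply.
Qed.

Lemma every_exit_true_not_countable : lang A = every_exit_true ->
  ~ countably_ambiguous A.
Proof.
move=> langA count; have [t [v tv] t_forcing] := forcing_tree A.
have : every_exit_true (spine (fun=> false) (fun=> t)).
  by move=> n; exists v; rewrite exit_spine.
rewrite -langA => -[phi /ACC_runs[phi0 run]].
have /choice[s sP] : forall n, exists s, infinite_set (runs (exit phi n [::]) s).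
  move=> n; have /t_forcing[[psi psiP]|[s]] := accepts_exit n run; last by exists s.
  (* If the state at exit [n] accepted the all-false tree, [A] would accept a tree with an all-false
     exit. *)
  have : lang A (spine (fun=> false) (fun j => if j == n then fun=> false else t)).
    exists (spine (trunk phi) (fun j => if j == n then psi else exit phi j)).
    apply/ACC_runs; split=> //; apply: (accepting_run_replace_exits run) => j.
    case: eqVneq => [->//|_]; split=> //.
    by have := accepting_run_exit j run; rewrite exit_spine.
  by rewrite langA => /(_ n)[w]; rewrite exit_spine eqxx.
have /choice[psi psiP] : forall n, exists psi : bool -> node -> pta_Q A,
    (forall b, runs (exit phi n [::]) (s n) (psi b)) /\ psi true <> psi false.
  move=> n; apply: contrapT => no_pair; apply: (sP n).
  have [[psi0 psi0P]|/set0P/negP/negPn/eqP->//] :=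
    pselect (runs (exit phi n [::]) (s n) !=set0).
  apply: (sub_finite_set _ (finite_set1 psi0)) => psi1 psi1P.
  apply: contrapT => ne; apply: no_pair.
  by exists (fun b => if b then psi1 else psi0); split=> // -[].
(* Choosing between two runs at each exit embeds all binary sequences into the runs on one tree. *)
pose F (f : nat -> bool) := spine (trunk phi) (fun n => psi n (f n)).
have FP f : ACC (spine (fun=> false) s) (F f).
  apply/ACC_runs; split=> //; apply: (accepting_run_replace_exits run) => n.
  by have [] := psiP n.
have /countable_injP[e e_inj] := count (spine (fun=> false) s).
apply: (@no_injection_functions_nat (e \o F)) => f g /e_inj.
rewrite !inE => /(_ (FP f) (FP g)) FE; apply/funext => n.
have [_ ne] := psiP n; have := congr1 (fun f => exit f n) FE.
rewrite !exit_spine; case: (f n); case: (g n) => // E; case: ne; rewrite ?E //.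
Qed.

End LowerBounds.

(** * Automata guessing an exit *)

Lemma max_inf_color_even_const c : ~~ odd c -> max_inf_color_even (fun=> c).
Proof.
by move=> c_even; exists c; split=> //; split=> [n|]; [exists n | exists 0].
Qed.

Section SpineAutomaton.
Variables (P : finType) (p0 : P).
Variable word_delta : P -> bool -> P -> option bool -> bool.
Variable word_col : P -> nat.

(* The states [inr e] run on the exits: [Some true] accepts every tree,
   [Some false] the all-false tree, and [None] searches for a true node. *)
Definition spine_pta : PTA bool := @MkPTA bool (P + option bool)%type
  (pred1 (inl p0))
  (fun q a q0 q1 => match q, q0, q1 with
    | inl p, inl p', inr e => word_delta p a p' e
    | inr (Some b), inr (Some b0), inr (Some b1) =>
        [&& b || ~~ a, b0 == b & b1 == b]
    | inr None, inr e0, inr e1 =>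
        [|| [&& a, e0 == Some true & e1 == Some true],
            (e0 == None) && (e1 == Some true) | (e0 == Some true) && (e1 == None)]
    | _, _, _ => false
    end)
  (fun q => match q with inl p => word_col p | inr e => e == None end).

Implicit Types phi : node -> pta_Q spine_pta.

Lemma runs_Some b t phi : runs (inr (Some b) : pta_Q spine_pta) t phi ->
  phi = (fun=> inr (Some b)) /\ (b = false -> forall v, t v = false).
Proof.
move=> [phi0 [valid _]].
have phiE v : phi v = inr (Some b).
  elim/last_ind: v => [//|v d IH]; have := valid v; rewrite IH.
  case E0: (phi (rcons v false)) => [//|[b0|]//].
  case E1: (phi (rcons v true)) => [//|[b1|]//].
  by case/and3P=> _ /eqP<- /eqP b1E; case: d; rewrite ?E0 ?E1 ?b1E.
split=> [|b0 v]; first exact/funext.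
by have := valid v; rewrite !phiE b0 => /and3P[/negbTE].
Qed.

Lemma accepting_run_const b (t : tree bool) : (b = false -> forall v, t v = false) ->
  @accepting_run _ spine_pta t (fun=> inr (Some b)).
Proof.
move=> tb; split=> [v|_]; last exact: max_inf_color_even_const.
rewrite /= eqxx !andbT; case: b tb => //= /(_ erefl) ->//.
Qed.

(** The search state has color 1 and, at a false node, is passed on to exactly one child; on an
    all-false tree it would fill a whole branch with an odd color. *)
Lemma accepts_search (t : tree bool) :
  accepts (inr None : pta_Q spine_pta) t <-> exists v, t v = true.
Proof.
split=> [[phi [phi0 [valid acc]]]|[v tv]].
  apply: contrapT => t_false.
  pose d v := phi (rcons v true) == inr None.
  pose path n := iter n (fun v => rcons v (d v)) [::].
  have pathE n : branch_node (d \o path) n = path n.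
    by elim: n => [//|n IH]; rewrite /branch_node mkseqS -/(branch_node _ _) IH.
  have search n : phi (path n) = inr None.
    elim: n => [//|n IH]; have := valid (path n); rewrite IH /= /d.
    have -> : t (path n) = false.
      by apply/negbTE/negP => tn; apply: t_false; exists (path n).
    case E0: (phi (rcons _ false)) => [//|e0]; case E1: (phi (rcons _ true)) => [//|e1].
    by rewrite /= => /orP[] /andP[/eqP e0E /eqP e1E]; rewrite e1E /= ?E0 ?E1 ?e0E ?e1E.
  have [c [c_even [c_inf _]]] := acc (d \o path).
  have [n _ cE] := c_inf 0; move: cE c_even; rewrite pathE search /=.
  by move=> <-.
elim: v t tv => [|d v IH] t tv.
  exists (graft (inr None) (fun=> inr (Some true)) (fun=> inr (Some true))).
  split=> //; apply/accepting_run_node; split; first by rewrite /= tv.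
  by case; exact: accepting_run_const.
have [psi [psi0 run]] := IH (subtree t [:: d]) tv.
exists (if d then graft (inr None) (fun=> inr (Some true)) psi
        else graft (inr None) psi (fun=> inr (Some true))).
split; first by case: (d).
apply/accepting_run_node; split.
  by case: (d); rewrite /= psi0 /= ?orbT; case: (t [::]); rewrite ?orbT.
by move: run; case: (d) => run; case=> //; exact: accepting_run_const.
Qed.

Definition word_run (h : nat -> bool) (pi : nat -> P) (e : nat -> option bool) :=
  [/\ pi 0 = p0, forall n, word_delta (pi n) (h n) (pi n.+1) (e n) &
      max_inf_color_even (word_col \o pi)].

Lemma ACC_spine_pta t phi : ACC t phi ->
  exists pi e, [/\ word_run (trunk t) pi e, trunk phi = inl \o pi &
    forall n, runs (inr (e n) : pta_Q spine_pta) (exit t n) (exit phi n)].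
Proof.
move=> /ACC_runs[/eqP phi0 run].
have /choice[pi piE] : forall n, exists p, trunk phi n = inl p.
  elim=> [|n [p pE]]; first by exists p0.
  have := accepting_run_trunk n run; rewrite pE.
  by case: (trunk phi n.+1) => // p' _; exists p'.
have /choice[e eE] : forall n, exists e, exit phi n [::] = inr e /\
    word_delta (pi n) (trunk t n) (pi n.+1) e.
  move=> n; have := accepting_run_trunk n run; rewrite !piE.
  by case: (exit phi n [::]) => // e ?; exists e.
exists pi, e; split.
- split=> [|n|]; last 1 first.
  + have := accepting_run_trunk_color run; congr max_inf_color_even.
    by apply/funext => n /=; rewrite piE.
  + by have := piE 0; rewrite /trunk phi0 => -[].
  + by have [] := eE n.
- by apply/funext => n; rewrite piE.
- by move=> n; have [eEn _] := eE n; split=> //; exact: accepting_run_exit.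
Qed.

Lemma spine_pta_ACC t pi e psi : word_run (trunk t) pi e ->
  (forall n, runs (inr (e n) : pta_Q spine_pta) (exit t n) (psi n)) ->
  ACC t (spine (inl \o pi) psi : node -> pta_Q spine_pta).
Proof.
move=> [pi0 valid good] psiP; apply/ACC_runs; split; first by rewrite /= pi0.
rewrite -[t]spine_eta; apply: accepting_run_spine => // n.
  by have [-> _] := psiP n; exact: valid.
by have [] := psiP n.
Qed.

End SpineAutomaton.

Lemma every_exit_true_regular : regular every_exit_true.
Proof.
pose A := spine_pta tt (fun _ _ _ e => e == None) (fun=> 0).
exists A; apply/seteqP; split=> t.
  move=> t_true; have /choice[psi psiP] : forall n,
      exists psi, runs (inr None : pta_Q A) (exit t n) psi.
    by move=> n; exact/accepts_search.
  exists (spine (inl \o fun=> tt) psi); apply: spine_pta_ACC psiP.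
  by split=> //; exact: max_inf_color_even_const.
move=> [phi /ACC_spine_pta[pi [e [[_ valid _] _ exitP]]]] n.
apply/(accepts_search tt (fun _ _ _ e => e == None) (fun=> 0)).
by exists (exit phi n); have := exitP n; rewrite (eqP (valid n)).
Qed.

(** * Automata choosing exactly one exit *)

Section ChoiceAutomaton.
Variables (P : finType) (p0 : P) (step : P -> bool -> bool -> option P).
Variables (col : P -> nat) (unchosen : pred P) (I : (nat -> bool) -> set nat).

(* [step p a false] guesses that the current exit is all-false. *)
Definition choice_delta p a p' (e : option bool) :=
  if e is Some b then step p a b == Some p' else false.

Definition choice_pta := spine_pta p0 choice_delta col.

Definition choice_run (h : nat -> bool) (pi : nat -> P) (b : nat -> bool) :=
  [/\ pi 0 = p0, forall n, step (pi n) (h n) (b n) = Some (pi n.+1) &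
      max_inf_color_even (col \o pi)].

Hypothesis unchosen_step : forall p a b p', step p a b = Some p' ->
  (unchosen p' -> unchosen p) /\ (b = false -> unchosen p && ~~ unchosen p').
Hypothesis choice_run_index : forall h pi b, choice_run h pi b ->
  exists2 i, b i = false & (forall n, b n = (n != i)) -> I h i.
Hypothesis index_choice_run : forall h i, I h i ->
  exists pi, choice_run h pi (fun n => n != i).

(** A choice leaves the [unchosen] states, and no step returns to them. *)
Lemma choice_run_unique h pi b i : choice_run h pi b -> b i = false ->
  forall n, b n = (n != i).
Proof.
move=> [_ valid _] bi.
have mono n m : n <= m -> unchosen (pi m) -> unchosen (pi n).
  elim: m => [|m IH]; first by rewrite leqn0 => /eqP->.
  rewrite leq_eqVlt => /orP[/eqP->//|/IH{}IH] um; apply: IH.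
  by have [+ _] := unchosen_step (valid m); apply.
have once n m : b n = false -> b m = false -> ~ n < m.
  move=> bn bm nm; have [_ /(_ bn)/andP[_]] := unchosen_step (valid n).
  have [_ /(_ bm)/andP[um _]] := unchosen_step (valid m).
  by rewrite (mono n.+1 m nm um).
move=> n; have [->//|ni] := eqVneq n i.
apply/negPn/negP => /negbTE bn.
by case: (ltngtP n i) ni => // lt _; [case: (once n i) | case: (once i n)].
Qed.

Lemma ACC_choice_pta t (phi : node -> pta_Q choice_pta) : ACC t phi ->
  exists i pi, [/\ I (trunk t) i, forall w, exit t i w = false,
    choice_run (trunk t) pi (fun n => n != i) &
    phi = spine (inl \o pi) (fun n _ => inr (Some (n != i)))].
Proof.
move=> /ACC_spine_pta[pi [e [[pi0 valid good] trunkE exitP]]].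
have /choice[b bE] : forall n, exists b, e n = Some b.
  by move=> n; have := valid n; rewrite /choice_delta; case: (e n) => // b; exists b.
have run : choice_run (trunk t) pi b.
  by split=> // n; have := valid n; rewrite /choice_delta bE => /eqP.
have [i bi /(_ (choice_run_unique run bi)) Ii] := choice_run_index run.
have bE' : b = (fun n => n != i) by apply/funext/(choice_run_unique run bi).
have exitE n : exit phi n = (fun=> inr (Some (n != i))) /\
    ((n != i) = false -> forall w, exit t n w = false).
  by have := exitP n; rewrite bE bE' => /runs_Some.
exists i, pi; split=> //.
- by have [_] := exitE i; rewrite eqxx; apply.
- by rewrite -bE'.
- rewrite -[LHS]spine_eta trunkE; congr spine; apply/funext => n.
  by have [] := exitE n.
Qed.

Lemma lang_choice_pta : lang choice_pta = some_exit_false I.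
Proof.
apply/seteqP; split=> [t [phi /ACC_choice_pta[i [pi [Ii ti _ _]]]]|t [i Ii ti]].
  by exists i.
have [pi [pi0 valid good]] := index_choice_run Ii.
exists (spine (inl \o pi) (fun n _ => inr (Some (n != i)))).
apply: (@spine_pta_ACC _ _ _ _ _ _ (fun n => Some (n != i))) => [|n].
  by split=> // n; rewrite /choice_delta valid.
split=> //; apply: accepting_run_const.
by case: eqVneq => [-> _|].
Qed.

(** As [step] is a function, the chosen index determines the trunk states, and the runs on the exits
    are constant; so each valid index has at most one run. *)
Lemma ACC_choice_pta_image t : exists R : nat -> node -> pta_Q choice_pta,
  ACC t `<=` R @` I (trunk t).
Proof.
have /choice[pi piP] : forall i, exists pi, I (trunk t) i ->
    choice_run (trunk t) pi (fun n => n != i).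
  move=> i; have [/index_choice_run[pi]|] := pselect (I (trunk t) i).
    by exists pi.
  by exists (fun=> p0).
exists (fun i => spine (inl \o pi i) (fun n _ => inr (Some (n != i)))).
move=> phi /ACC_choice_pta[i [pi' [Ii _ [pi'0 valid' _] ->]]]; exists i => //.
congr (spine (inl \o _) _); apply/funext => n.
have [pi0 valid _] := piP i Ii.
elim: n => [|n IH]; first by rewrite pi0 pi'0.
by have := valid' n; rewrite -IH valid => -[].
Qed.

End ChoiceAutomaton.

(** * The hierarchy *)

Lemma size_of_injection (T : eqType) (s : seq T) (g : nat -> T) n :
  (forall i, i < n -> g i \in s) ->
  (forall i j, i < n -> j < n -> g i = g j -> i = j) -> n <= size s.
Proof.
move=> gs g_inj; rewrite -[n](size_iota 0) -(size_map g); apply: uniq_leq_size.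
  rewrite map_inj_in_uniq ?iota_uniq // => i j.
  by rewrite !mem_iota !add0n => /andP[_ ?] /andP[_ ?]; exact: g_inj.
by move=> _ /mapP[i + ->]; rewrite mem_iota => /andP[_]; exact: gs.
Qed.

Lemma k_ambiguous_finite (A : PTA bool) k : k_ambiguous A k -> finitely_ambiguous A.
Proof.
move=> amb t; have [f ft] := amb t; apply: sub_finite_set ft _.
by apply/finite_image/finite_finset.
Qed.

Lemma k_ambiguous_leq (A : PTA bool) I h k n : lang A = some_exit_false I ->
  k_ambiguous A k -> 0 < n -> (forall i, i < n -> I h i) -> n <= k.
Proof.
move=> langA amb n_gt0 In.
have [|g [gP g_inj]] := @some_exit_false_runs A I h langA (k_ambiguous_finite amb).
  by exists 0; exact: In.
have [f ft] := amb (spine h (fun=> fun=> false)).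
rewrite -[k]size_enum_ord -(size_map f).
apply: (@size_of_injection _ _ g) => [i /In/gP/ft[j _ <-]|i j iN jN].
  by apply: map_f; rewrite mem_enum.
by apply: g_inj; exact: In.
Qed.

(** * Choice among the first [k] exits *)

Section BoundedSearch.
Variable k : nat.

Definition bounded_index (h : nat -> bool) : set nat := [set i | i < k].

(** [Some i] counts the exits passed so far and [None] means chosen. The counter cannot move past
    [k - 1], which forces a choice in time. *)
Definition bounded_step (p : option 'I_k) (a b : bool) : option (option 'I_k) :=
  if p is Some i then (if b then omap Some (insub i.+1) else Some None)
  else if b then Some None else None.

Hypothesis k_gt0 : 0 < k.

Definition bounded_pta :=
  choice_pta (Some (Ordinal k_gt0)) bounded_step (fun=> 0).

Let unchosen (p : option 'I_k) := p != None.

Lemma bounded_unchosen p a b p' : bounded_step p a b = Some p' ->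
  (unchosen p' -> unchosen p) /\ (b = false -> unchosen p && ~~ unchosen p').
Proof. by case: p => [i|]; case: b => //= -[<-]. Qed.

Lemma bounded_run_index h pi b :
  choice_run (Some (Ordinal k_gt0)) bounded_step (fun=> 0) h pi b ->
  exists2 i, b i = false & (forall n, b n = (n != i)) -> bounded_index h i.
Proof.
move=> [pi0 valid _].
have piE n : (forall i, i < n -> b i = true) -> omap val (pi n) = Some n.
  elim: n => [|n IH] bn; first by rewrite pi0.
  have := IH (fun i i_lt => bn i (ltnW i_lt)).
  have := valid n; rewrite bn //; case: (pi n) => //= i + [iE].
  by rewrite iE; case: insubP => //= j _ <- [<-].
have [i [bi ltb]] : exists i, b i = false /\ forall j, j < i -> b j = true.
  have [all|/existsNP ex] := pselect (forall i, b i = true).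
    have := piE k (fun i _ => all i); case: (pi k) => //= i [iE].
    by have := ltn_ord i; rewrite iE ltnn.
  have ex' : exists i, ~~ b i by case: ex => i /negP bi; exists i.
  case: (ex_minnP ex') => i /negbTE bi i_min; exists i; split=> // j ji.
  by apply/negPn/negP => /i_min; rewrite leqNgt ji.
exists i => // _; have := piE i ltb; case: (pi i) => //= j [<-].
exact: ltn_ord.
Qed.

Lemma bounded_index_run h i : bounded_index h i -> exists pi,
  choice_run (Some (Ordinal k_gt0)) bounded_step (fun=> 0) h pi (fun n => n != i).
Proof.
move=> ik; exists (fun n => if n <= i then insub n else None); split.
- by rewrite /= insubT; congr Some; apply: val_inj.
- move=> n; have [ni|ni] := leqP n i; last first.
    by rewrite (ltnNge n i) (ltnW ni) gtn_eqF.
  have nk : n < k by exact: leq_ltn_trans ni ik.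
  rewrite insubT /=; case: eqVneq => [->|ne]; first by rewrite ltnn.
  have n1 : n < i by rewrite ltn_neqAle ne.
  by rewrite n1 insubT //; apply: leq_ltn_trans n1 ik.
- exact: max_inf_color_even_const.
Qed.

Lemma bounded_lang : k_ambiguous_lang (some_exit_false bounded_index) k.
Proof.
exists bounded_pta; split.
  by rewrite (lang_choice_pta bounded_unchosen bounded_run_index bounded_index_run).
move=> t; have [R RP] := ACC_choice_pta_image
  bounded_unchosen bounded_run_index bounded_index_run t.
by exists (fun i => R i) => phi /RP[i ik <-]; exists (Ordinal (ik : i < k)).
Qed.

End BoundedSearch.

(** * Choice before the first mark on the trunk *)

Definition marked_index (h : nat -> bool) : set nat :=
  [set i | exists2 n, i < n & h n /\ forall j, j < n -> h j = false].

(* [Some true]: no exit chosen yet; [Some false]: chosen, waiting for the mark;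
   [None]: mark seen. *)
Definition marked_step (p : option bool) (a b : bool) : option (option bool) :=
  match p, a, b with
  | Some true, false, _ => Some (Some b)
  | Some false, _, true => Some (if a then None else Some false)
  | None, _, true => Some None
  | _, _, _ => None
  end.

(** Color 1 before the mark rules out waiting for it forever. *)
Definition marked_col (p : option bool) : nat := p != None.

Lemma marked_unchosen p a b p' : marked_step p a b = Some p' ->
  (p' == Some true -> p == Some true) /\
  (b = false -> (p == Some true) && (p' != Some true)).
Proof. by case: p => [[]|]; case: a; case: b => //= -[<-]. Qed.

Lemma even_col_false (P : Type) (c : P -> bool) (pi : nat -> P) :
  max_inf_color_even ((fun p => c p : nat) \o pi) -> exists n, c (pi n) = false.
Proof.
move=> [m [m_even [/(_ 0)[n _ /= cE] _]]]; exists n.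
by move: m_even; rewrite -cE; case: (c _).
Qed.

Lemma marked_run_index h pi b :
  choice_run (Some true) marked_step marked_col h pi b ->
  exists2 i, b i = false & (forall n, b n = (n != i)) -> marked_index h i.
Proof.
move=> [pi0 valid /even_col_false[m /negbFE/eqP pim]].
have ex : exists m, pi m == None by exists m; rewrite pim.
(* State [None] is first reached at time [n.+1], so the mark is at [n]. *)
case: (ex_minnP ex) => -[|n] /eqP pin n_min; first by rewrite pi0 in pin.
have before j : j <= n -> pi j != None.
  by move=> jn; apply/negP => /n_min; rewrite ltnNge jn.
have pin' : pi n = Some false /\ h n.
  have := valid n; have := before n (leqnn n); rewrite pin.
  by case: (pi n) => [[]|] //; case: (h n); case: (b n).
have hj j : j < n -> h j = false.
  move=> jn; have := valid j; have := before j (ltnW jn); have := before j.+1 jn.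
  by case: (pi j) (pi j.+1) => [[]|] [p'|] //; case: (h j); case: (b j).
(* Without an earlier choice the state at [n] would still be [Some true] instead of [Some false]. *)
have [i [lt_in bi]] : exists i, i < n /\ b i = false.
  apply: contrapT => nex.
  have all j : j <= n -> pi j = Some true.
    elim: j => [//|j IH] jn; have := valid j; rewrite IH ?(ltnW jn) // hj //=.
    case bj : (b j) => -[<-] //.
    by case: nex; exists j.
  by have := all n (leqnn n); rewrite pin'.1.
exists i => // _; exists n => //; split=> //; exact: pin'.2.
Qed.

Lemma marked_index_run h i : marked_index h i -> exists pi,
  choice_run (Some true) marked_step marked_col h pi (fun n => n != i).
Proof.
move=> [n lt_in [hn hj]].
exists (fun j => if j <= i then Some true else if j <= n then Some false else None).
split=> // [j|].
  have [ji|ij] := leqP j i.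
    rewrite hj; last by exact: leq_ltn_trans ji lt_in.
    case: eqVneq => [->|ne] /=; first by rewrite ltnn lt_in.
    by rewrite ltn_neqAle ne ji.
  rewrite gtn_eqF // ltnNge (ltnW ij) /=.
  have [jn|//|->] := ltngtP j n; first by rewrite hj.
  by rewrite hn.
exists 0; split=> //; split=> [m|].
  exists (maxn m n.+1); first exact: leq_maxl.
  have mn : n < maxn m n.+1 by exact: leq_maxr.
  by rewrite /= leqNgt (ltn_trans lt_in mn) leqNgt mn.
exists n.+1 => m nm.
by rewrite /= (leqNgt m i) (ltn_trans lt_in nm) (leqNgt m n) nm.
Qed.

Lemma marked_lang_finite : finitely_ambiguous_lang (some_exit_false marked_index).
Proof.
exists (choice_pta (Some true) marked_step marked_col); split.
  by rewrite (lang_choice_pta marked_unchosen marked_run_index marked_index_run).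
move=> t; have [R RP] :=
  ACC_choice_pta_image marked_unchosen marked_run_index marked_index_run t.
apply: sub_finite_set RP _; apply: finite_image.
have [[_ [n _ [hn _]]]|/set0P/negP/negPn/eqP->] :=
  pselect (marked_index (trunk t) !=set0); last exact: finite_set0.
apply: (sub_finite_set _ (finite_II n)) => i [m im [_ hj]] /=.
by apply: leq_trans im _; rewrite leqNgt; apply/negP => /hj; rewrite hn.
Qed.

Lemma marked_lang_unbounded :
  ~ boundedly_ambiguous_lang (some_exit_false marked_index).
Proof.
move=> [A [langA [k amb]]].
have : k.+1 <= k; last by rewrite ltnn.
(* A single mark at [k.+1] makes all of the [k.+1] smaller indices valid. *)
apply: (k_ambiguous_leq (h := fun n => n == k.+1) (esym langA) amb) => // i ik.
by exists k.+1 => //; split=> // j; exact: ltn_eqF.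
Qed.

(** * Choice of an arbitrary exit *)

Definition any_index (h : nat -> bool) : set nat := setT.

(** State [true] means not yet chosen; under the coloring [nat_of_bool] it has color 1, so the
    choice cannot be postponed forever. *)
Definition any_step (p a b : bool) : option bool :=
  if p then Some b else if b then Some false else None.

Lemma any_unchosen p a b p' : any_step p a b = Some p' ->
  (p' -> p) /\ (b = false -> p && ~~ p').
Proof. by case: p; case: b => //= -[<-]. Qed.

Lemma any_run_index h pi b : choice_run true any_step nat_of_bool h pi b ->
  exists2 i, b i = false & (forall n, b n = (n != i)) -> any_index h i.
Proof.
move=> [pi0 valid /(@even_col_false _ id)[m pim]].
have [all|/existsNP[i /negP/negbTE bi]] := pselect (forall i, b i = true).
  suff : pi m = true by rewrite pim.
  elim: m {pim} => [//|m IH]; have := valid m.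
  by rewrite IH all => -[<-].
by exists i.
Qed.

Lemma any_index_run h i : any_index h i -> exists pi,
  choice_run true any_step nat_of_bool h pi (fun n => n != i).
Proof.
move=> _; exists (fun j => j <= i); split=> // [j|].
  rewrite /any_step; have [ji|ij] := leqP j i; first by rewrite ltn_neqAle ji andbT.
  by rewrite gtn_eqF // ltnNge (ltnW ij).
exists 0; split=> //; split=> [m|].
  exists (maxn m i.+1); first exact: leq_maxl.
  by rewrite /= leqNgt leq_maxr.
by exists i.+1 => m im; rewrite /= leqn0 eqb0 -ltnNge.
Qed.

Lemma any_lang_countable : countably_ambiguous_lang (some_exit_false any_index).
Proof.
exists (choice_pta true any_step nat_of_bool); split.
  by rewrite (lang_choice_pta any_unchosen any_run_index any_index_run).
move=> t; have [R RP] :=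
  ACC_choice_pta_image any_unchosen any_run_index any_index_run t.
apply: (sub_countable (subset_card_le RP)).
exact: (sub_countable (card_image_le _ _)) (countableP _).
Qed.

Lemma any_lang_infinite : ~ finitely_ambiguous_lang (some_exit_false any_index).
Proof.
move=> [A [langA fin]].
have [|g [gP g_inj]] :=
  @some_exit_false_runs A any_index (fun=> false) (esym langA) fin.
  by exists 0.
have /finite_seqP[s sE] := fin (spine (fun=> false) (fun=> fun=> false)).
have : (size s).+1 <= size s; last by rewrite ltnn.
apply: (@size_of_injection _ _ g) => [i _|i j _ _]; last exact: g_inj.
by have : [set` s] (g i) by rewrite -sE; exact: gP.
Qed.

Theorem theorem1p1 :
  (forall k : nat, 1 < k ->
     exists (Sigma : finType) (L : tree_language Sigma),
       k_ambiguous_lang L k /\ ~ k_ambiguous_lang L k.-1) /\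
  (exists (Sigma : finType) (L : tree_language Sigma),
     finitely_ambiguous_lang L /\ ~ boundedly_ambiguous_lang L) /\
  (exists (Sigma : finType) (L : tree_language Sigma),
     countably_ambiguous_lang L /\ ~ finitely_ambiguous_lang L) /\
  (exists (Sigma : finType) (L : tree_language Sigma),
     regular L /\ ~ countably_ambiguous_lang L).
Proof.
split=> [k k_gt1|].
  have k_gt0 : 0 < k by exact: ltnW.
  exists bool, (some_exit_false (bounded_index k)); split.
    exact: bounded_lang.
  move=> [A [langA amb]]; have : k <= k.-1; last by rewrite leqNgt ltn_predL k_gt0.
  exact: (k_ambiguous_leq (h := fun=> false) (esym langA) amb).
split; first by exists bool, (some_exit_false marked_index); split;
  [exact: marked_lang_finite | exact: marked_lang_unbounded].
split; first by exists bool, (some_exit_false any_index); split;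
  [exact: any_lang_countable | exact: any_lang_infinite].
exists bool, every_exit_true; split; first exact: every_exit_true_regular.
move=> [A [langA]]; exact: every_exit_true_not_countable.
Qed.
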